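(* Let $x_1,\dots,x_m\in\mathbb{R}^n$, let $P_1,\dots,P_m\in\mathbb{R}^{n\times n}$ be symmetric positive definite, and assume that the intersection $\mathscr{F}=\bigcap_{i=1}^m\{x\in\mathbb{R}^n:(x-x_i)^TP_i^{-1}(x-x_i)\le1\}$ is a nonempty bounded region. Let the objective function be $f(P)=\log\det(P)$ or $f(P)=\operatorname{tr}(P)$. Let $\mathscr{D}^+=\{t\in\mathbb{R}^m:t_i\ge0,\ \sum_{i=1}^mt_i=1\}$ and for $t\in\mathscr{D}^+$ put $$P_t^{-1}=\sum_{i=1}^mt_iP_i^{-1},\quad x_t=P_t\sum_{i=1}^mt_iP_i^{-1}x_i,\quad \delta_t=\sum_{i=1}^mt_ix_i^TP_i^{-1}x_i-x_t^TP_t^{-1}x_t.$$ Consider the bounding ellipsoid relaxation (B): minimize $f((1-\delta_t)P_t)$ over $t\in\mathscr{D}^+$. Consider the decoupled SDP relaxation (D): minimize $f\Big(\big(\sum_{i=1}^m\lambda_iP_i^{-1}\big)^{-1}\Big)$ over $\lambda_1,\dots,\lambda_m\ge0$ subject to $$\begin{bmatrix}1-\sum_{i=1}^m\lambda_i+\sum_{i=1}^m\lambda_ix_i^TP_i^{-1}x_i & \sum_{i=1}^m\lambda_ix_i^TP_i^{-1}\\ \sum_{i=1}^m\lambda_iP_i^{-1}x_i&\sum_{i=1}^m\lambda_iP_i^{-1}\end{bmatrix}\succeq 0.$$ Then (B) is equivalent to (D), i.e., they have the same minimum ellipsoid to contain the intersection $\mathscr{F}$.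
   Context: The ellipsoid with center $c$ and shape matrix $P$ is $\{x\in\mathbb{R}^n:(x-c)^TP^{-1}(x-c)\le1\}$. An optimal $t$ of (B) gives the ellipsoid with center $x_t$ and shape matrix $(1-\delta_t)P_t$. An optimal $\lambda$ of (D) gives the ellipsoid with shape matrix $P_0=\big(\sum_{i=1}^m\lambda_iP_i^{-1}\big)^{-1}$ and center $x_0=P_0\sum_{i=1}^m\lambda_iP_i^{-1}x_i$. $A\succeq0$ means $A$ is symmetric positive semidefinite. *)

(* Defs.v *)
From HB Require Import structures.
From mathcomp Require Import all_boot all_order all_algebra.
From mathcomp Require Import all_classical all_reals all_analysis.

Set Implicit Arguments.
Unset Strict Implicit.
Unset Printing Implicit Defensive.

Import Order.TTheory GRing.Theory Num.Theory.
Import numFieldNormedType.Exports.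

Local Open Scope classical_set_scope.
Local Open Scope ring_scope.

Section Matrices.
Context {R : realType}.

Definition quad_form (n : nat) (A : 'M[R]_n) (v : 'cV[R]_n) : R :=
  (v^T *m A *m v) 0 0.

Definition posdefmx (n : nat) (A : 'M[R]_n) : Prop :=
  A^T = A /\ forall v : 'cV[R]_n, v != 0 -> 0 < quad_form A v.

Definition possemidefmx (n : nat) (A : 'M[R]_n) : Prop :=
  A^T = A /\ forall v : 'cV[R]_n, 0 <= quad_form A v.

(* [invmx] is a genuine inverse only on [unitmx], so this is an ellipsoid only
   for an invertible (below: positive definite) shape matrix [P]. *)
Definition ellipsoid (n : nat) (c : 'cV[R]_n) (P : 'M[R]_n) : set 'cV[R]_n :=
  [set z | quad_form (invmx P) (z - c) <= 1].

(* [lne] is the extended logarithm: log det P is -oo when \det P = 0. *)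
Definition logdet (n : nat) (P : 'M[R]_n) : \bar R := lne (\det P)%:E.

Definition trace (n : nat) (P : 'M[R]_n) : \bar R := (\tr P)%:E.

End Matrices.

Definition minimizer {R : realType} {T : Type} (A : set T) (g : T -> \bar R)
    (a : T) : Prop :=
  A a /\ forall b, A b -> (g a <= g b)%E.

(* [B_*]: the bounding ellipsoid relaxation (minimize f((1 - delta_t) P_t) over
   the simplex); [D_*]: the decoupled SDP relaxation. *)
Section Relaxations.
Context {R : realType} {m n : nat}.
Variables (x : 'I_m -> 'cV[R]_n) (P : 'I_m -> 'M[R]_n).
Variable f : 'M[R]_n -> \bar R.

Definition intersection : set 'cV[R]_n :=
  \bigcap_(i in [set: 'I_m]) ellipsoid (x i) (P i).

(* For weights w: sum_i w_i P_i^-1, sum_i w_i P_i^-1 x_i and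
   sum_i w_i x_i^T P_i^-1 x_i. *)
Definition winv (w : 'rV[R]_m) : 'M[R]_n :=
  \sum_(i < m) w 0 i *: invmx (P i).

Definition wlin (w : 'rV[R]_m) : 'cV[R]_n :=
  \sum_(i < m) w 0 i *: (invmx (P i) *m x i).

Definition wquad (w : 'rV[R]_m) : R :=
  \sum_(i < m) w 0 i * quad_form (invmx (P i)) (x i).

(* P_t and x_t for t in the simplex; the same formulas give P_0 and x_0
   when w is feasible for the decoupled SDP. *)
Definition wshape (w : 'rV[R]_m) : 'M[R]_n := invmx (winv w).

Definition wcenter (w : 'rV[R]_m) : 'cV[R]_n := wshape w *m wlin w.

Definition delta (t : 'rV[R]_m) : R :=
  wquad t - quad_form (winv t) (wcenter t).

Definition simplex : set 'rV[R]_m :=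
  [set t : 'rV[R]_m | (forall i, 0 <= t 0 i) /\ \sum_(i < m) t 0 i = 1].

Definition B_shape (t : 'rV[R]_m) : 'M[R]_n := (1 - delta t) *: wshape t.

Definition B_objective (t : 'rV[R]_m) : \bar R := f (B_shape t).

Definition B_min_ellipsoid (c : 'cV[R]_n) (S : 'M[R]_n) : Prop :=
  exists2 t, minimizer simplex B_objective t & c = wcenter t /\ S = B_shape t.

Definition D_matrix (l : 'rV[R]_m) : 'M[R]_(1 + n) :=
  block_mx (1 - \sum_(i < m) l 0 i + wquad l)%:M
           (\sum_(i < m) l 0 i *: ((x i)^T *m invmx (P i)))
           (wlin l)
           (winv l).

(* The objective of the SDP involves (winv l)^-1, so the invertibility of [winv l]
   is part of the domain; it excludes l = 0 when 0 < n. *)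
Definition D_feasible : set 'rV[R]_m :=
  [set l : 'rV[R]_m | [/\ forall i, 0 <= l 0 i, winv l \in unitmx
             & possemidefmx (D_matrix l)]].

Definition D_objective (l : 'rV[R]_m) : \bar R := f (wshape l).

Definition D_min_ellipsoid (c : 'cV[R]_n) (S : 'M[R]_n) : Prop :=
  exists2 l, minimizer D_feasible D_objective l
           & c = wcenter l /\ S = wshape l.

End Relaxations.

(* Main.v *)
Require Import Defs.
From HB Require Import structures.
From mathcomp Require Import all_boot all_order all_algebra.
From mathcomp Require Import all_classical all_reals all_analysis.
From mathcomp Require Import ring lra.
Import Order.TTheory GRing.Theory Num.Theory.
Import numFieldNormedType.Exports.
Local Open Scope classical_set_scope.
Local Open Scope ring_scope.

(* Completing the square turns any weighted sum of the inequalities defining F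
   into (z - x_t)^T P_t^-1 (z - x_t) <= 1 - delta_t, so F lies in the ellipsoid of
   (B), and 1 - delta_t is nonnegative because F is nonempty.  Write a nonzero
   weight vector of (D) as s t with s > 0 and t in the simplex.  By a Schur
   complement its feasibility is s (1 - delta_t) <= 1, and its shape matrix is
   P_t / s with the same center x_t.  As f is strictly increasing along positive
   multiples of P_t, the best choice is 1 / s = 1 - delta_t, which is exactly the
   shape matrix of (B); if 1 - delta_t = 0, let s tend to infinity.  Existence
   of a minimizer follows by compactness of the simplex, an interior point of F
   forcing 1 - delta_t > 0. *)

Set Implicit Arguments.
Unset Strict Implicit.

(** * Quadratic forms and positive definite matrices *)

Lemma quad_form_ge0 (R : realType) n (A : 'M[R]_n) v :
  posdefmx A -> 0 <= quad_form A v.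
Proof.
move=> [_ A_gt0]; have [->|/A_gt0/ltW//] := eqVneq v 0.
by rewrite /quad_form mulmx0 mxE.
Qed.

Lemma mx11_trE (R : realType) (A : 'M[R]_1) : A 0 0 = A^T 0 0.
Proof. by rewrite mxE. Qed.

Lemma quad_form_sub (R : realType) n (A : 'M[R]_n) z c : A^T = A ->
  quad_form A (z - c) =
  quad_form A z - (z^T *m A *m c) 0 0 *+ 2 + quad_form A c.
Proof.
move=> A_sym; rewrite /quad_form [(z - c)^T]linearB /= !(mulmxBl, mulmxBr).
have mxB (B C : 'M[R]_1) : (B - C) 0 0 = B 0 0 - C 0 0 by rewrite !mxE.
rewrite !mxB.
have -> : (c^T *m A *m z) 0 0 = (z^T *m A *m c) 0 0.
  by rewrite [LHS]mx11_trE !trmx_mul trmxK A_sym mulmxA.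
by rewrite mulr2n; ring.
Qed.

Lemma quad_formZ (R : realType) n (a : R) (A : 'M[R]_n) v :
  quad_form (a *: A) v = a * quad_form A v.
Proof. by rewrite /quad_form -scalemxAr -scalemxAl mxE. Qed.

(** A nonzero vector in the left kernel would make the quadratic form vanish. *)
Lemma posdef_unitmx (R : realType) n (A : 'M[R]_n) :
  posdefmx A -> A \in unitmx.
Proof.
move=> [_ A_gt0]; rewrite -row_free_unit -kermx_eq0.
apply: contraT => /rowV0Pn[v] /sub_kermxP vA0 v_neq0; have := A_gt0 v^T.
by rewrite /quad_form trmxK vA0 mul0mx mxE ltxx trmx_eq0 => /(_ v_neq0).
Qed.

(** Substituting [v = A u] turns the form of [invmx A] at [v] into the form of [A] at [u]. *)
Lemma posdef_invmx (R : realType) n (A : 'M[R]_n) :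
  posdefmx A -> posdefmx (invmx A).
Proof.
move=> A_pd; have A_unit := posdef_unitmx A_pd.
case: A_pd => A_sym A_gt0; split=> [|v v_neq0]; first by rewrite trmx_inv A_sym.
have -> : quad_form (invmx A) v = quad_form A (invmx A *m v).
  by rewrite /quad_form trmx_mul trmx_inv A_sym mulmxA mulmxKV.
apply: A_gt0; apply: contra_neq v_neq0 => Av0.
by rewrite -[v](mulKVmx A_unit) Av0 mulmx0.
Qed.

Lemma posdefZ (R : realType) n (a : R) (A : 'M[R]_n) :
  0 < a -> posdefmx A -> posdefmx (a *: A).
Proof.
move=> a_gt0 [A_sym A_gt0]; split=> [|v /A_gt0 Av].
  by rewrite linearZ /= A_sym.
by rewrite quad_formZ mulr_gt0.
Qed.

Lemma posdef_diag_gt0 (R : realType) n (A : 'M[R]_n) i :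
  posdefmx A -> 0 < A i i.
Proof.
move=> [_ A_gt0]; have := A_gt0 (delta_mx i 0).
rewrite /quad_form trmx_delta -rowE -colE !mxE; apply.
apply/eqP => /matrixP/(_ i 0); rewrite !mxE !eqxx /=.
by move/eqP; rewrite oner_eq0.
Qed.

Lemma posdef_trace_gt0 (R : realType) n (A : 'M[R]_n) : (0 < n)%N ->
  posdefmx A -> 0 < \tr A.
Proof.
case: n A => // n A _ A_pd; rewrite /mxtrace big_ord_recl.
rewrite ltr_wpDr ?posdef_diag_gt0 //.
by apply: sumr_ge0 => i _; rewrite ltW // posdef_diag_gt0.
Qed.

(** Induction on the size: the determinant is the corner entry times the determinant of its Schur
    complement, which is again positive definite. *)
Lemma posdef_det_gt0 (R : realType) n (A : 'M[R]_n) :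
  posdefmx A -> 0 < \det A.
Proof.
elim: n A => [|n IHn] A A_pd; first by rewrite det_mx00.
have a_gt0 : 0 < A 0 0 by exact: posdef_diag_gt0.
have a_neq0 := lt0r_neq0 a_gt0.
have [A_sym A_gt0] := A_pd.
set B : 'M[R]_(1 + n) := A.
have B_sym : B^T = B by exact: A_sym.
pose a := B 0 0; pose b := dlsubmx B; pose D := drsubmx B.
have ur : ursubmx B = b^T by rewrite /b trmx_dlsub B_sym.
have ul : ulsubmx B = a%:M.
  rewrite [LHS]mx11_scalar !mxE; congr (B _ _)%:M; exact: val_inj.
have BE : B = block_mx a%:M b^T b D by rewrite -[LHS]submxK ul ur.
pose S := D - a^-1 *: (b *m b^T).
have S_sym : S^T = S.
  by rewrite linearB /= linearZ /= trmx_mul trmxK trmx_drsub B_sym.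
(* One step of Gaussian elimination: [L] has determinant 1 and clears the column [b]. *)
pose L : 'M[R]_(1 + n) := block_mx 1%:M 0 (- a^-1 *: b) 1%:M.
have LB : L *m B = block_mx a%:M b^T 0 S.
  rewrite BE mulmx_block !mul1mx !mul0mx !addr0 -!scalemxAl mul_mx_scalar.
  by rewrite scalerA mulNr mulVf // scaleN1r addNr scaleNr addrC.
have -> : \det A = a * \det S.
  have := congr1 determinant LB; rewrite det_mulmx det_lblock det_ublock.
  by rewrite !det1 !mul1r det_scalar1.
rewrite mulr_gt0 // IHn //; split => // v v_neq0.
have Sv : v^T *m S *m v = v^T *m D *m v - a^-1 *: (v^T *m b *m (b^T *m v)).
  by rewrite mulmxBr mulmxBl -scalemxAr -scalemxAl !mulmxA.
(* This [w] solves a w + b^T v = 0, so the first block of [B *m col_mx w v] vanishes and only the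
   Schur complement contributes. *)
pose w := - a^-1 *: (b^T *m v).
have := A_gt0 (col_mx w v : 'cV[R]_(1 + n)); rewrite -/B.
have -> : quad_form B (col_mx w v) = quad_form S v.
  rewrite /quad_form BE tr_col_mx mul_row_block mul_row_col.
  rewrite Sv /w [(_ *: _)^T]linearZ /= trmx_mul trmxK mul_mx_scalar scalerA.
  rewrite mulrN divff //.
  rewrite scaleN1r addNr mul0mx add0r mulmxDl -scalemxAl -scalemxAl scaleNr.
  by rewrite [in LHS]addrC !mulmxA.
apply; apply: contra_neq v_neq0 => wv0.
have := congr1 (fun u : 'cV[R]_(1 + n) => dsubmx u) wv0.
by rewrite col_mxKd linear0.
Qed.

(** * Weighted sums of ellipsoid inequalities and the constraint of (D) *)

Section WeightedEllipsoids.
Context {R : realType} {m n : nat} (x : 'I_m -> 'cV[R]_n) (P : 'I_m -> 'M[R]_n).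
Context (P_posdef : forall i, posdefmx (P i)).
Implicit Types (w t : 'rV[R]_m) (z v : 'cV[R]_n).

Let winv := winv P.
Let wlin := wlin x P.
Let wquad := wquad x P.
Let wcenter := wcenter x P.
Let wshape := wshape P.
Let delta := delta x P.

Lemma quad_form_winv w v :
  quad_form (winv w) v = \sum_(i < m) w 0 i * quad_form (invmx (P i)) v.
Proof.
rewrite /quad_form mulmx_sumr mulmx_suml summxE; apply: eq_bigr => i _.
by rewrite -scalemxAr -scalemxAl mxE.
Qed.

Lemma winv_sym w : (winv w)^T = winv w.
Proof.
rewrite [LHS]raddf_sum; apply: eq_bigr => i _.
by rewrite /= linearZ /= trmx_inv (P_posdef i).1.
Qed.

Lemma trmx_wlin w :
  (wlin w)^T = \sum_(i < m) w 0 i *: ((x i)^T *m invmx (P i)).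
Proof.
rewrite [LHS]raddf_sum; apply: eq_bigr => i _.
by rewrite /= linearZ /= trmx_mul trmx_inv (P_posdef i).1.
Qed.

(** If the weighted sum of positive forms vanished at some [v != 0], every weight would be zero,
    against the positive total weight. *)
Lemma winv_posdef w : (forall i, 0 <= w 0 i) -> 0 < \sum_(i < m) w 0 i ->
  posdefmx (winv w).
Proof.
move=> w_ge0 w_gt0; split=> [|v v_neq0]; first exact: winv_sym.
have q_gt0 i : 0 < quad_form (invmx (P i)) v.
  by have [_] := posdef_invmx (P_posdef i); apply.
rewrite quad_form_winv lt_neqAle sumr_ge0 ?andbT => [|i _]; last first.
  by rewrite mulr_ge0 // ltW.
rewrite eq_sym; apply: contraTneq w_gt0 => /psumr_eq0P q0.
rewrite big1 ?ltxx // => i _; apply/eqP.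
have /eqP := q0 (fun i _ => mulr_ge0 (w_ge0 i) (ltW (q_gt0 i))) i isT.
by rewrite mulf_eq0 (gt_eqF (q_gt0 i)) orbF.
Qed.

Lemma winv_wcenter w : winv w \in unitmx -> winv w *m wcenter w = wlin w.
Proof. by move=> w_unit; rewrite [LHS]mulKVmx. Qed.

(** Completing the square in [z]: the center absorbs the linear term and [delta w] collects the
    constants. *)
Lemma weighted_quad_form w z : winv w \in unitmx ->
  \sum_(i < m) w 0 i * quad_form (invmx (P i)) (z - x i) =
  quad_form (winv w) (z - wcenter w) + delta w.
Proof.
move=> w_unit; rewrite quad_form_sub ?winv_sym // -mulmxA winv_wcenter //.
rewrite /delta /Defs.delta -/(winv w) -/(wcenter w) quad_form_winv.
rewrite /wlin /Defs.wlin mulmx_sumr summxE /wquad /Defs.wquad.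
rewrite addrACA subrr addr0 -sumrMnl -sumrB -big_split /=.
apply: eq_bigr => i _.
rewrite quad_form_sub ?trmx_inv ?(P_posdef i).1 // -scalemxAr mulmxA [in RHS]mxE.
by rewrite mulrDr mulrBr mulrnAr.
Qed.

(** Completing the square in [v] separates the Schur complement from a square that vanishes at
    [v = - a *: wcenter w]. Every vector of size [1 + n] has the form [col_mx a%:M v]. *)
Lemma quad_form_D_matrix w (a : R) v : winv w \in unitmx ->
  quad_form (D_matrix x P w) (col_mx a%:M v) =
  a ^+ 2 * (1 - \sum_(i < m) w 0 i + delta w)
    + quad_form (winv w) (v + a *: wcenter w).
Proof.
move=> w_unit; rewrite -[in RHS](opprK (a *: _)) quad_form_sub ?winv_sym //.
have mxZ b (B : 'M[R]_1) : (b *: B) 0 0 = b * B 0 0 by rewrite mxE.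
have -> : quad_form (D_matrix x P w) (col_mx a%:M v) =
    a ^+ 2 * (1 - \sum_(i < m) w 0 i + wquad w)
    + a * (v^T *m wlin w) 0 0 *+ 2 + quad_form (winv w) v.
  rewrite /quad_form /D_matrix -trmx_wlin -/(wlin w) -/(winv w) -/(wquad w).
  rewrite (@tr_col_mx _ 1 n 1) (@mul_row_block _ 1 1 n 1 n).
  rewrite (@mul_row_col _ 1 1 n 1).
  rewrite tr_scalar_mx !mulmxDl !mul_scalar_mx !mul_mx_scalar -scalemxAl.
  have -> : (wlin w)^T *m v = v^T *m wlin w.
    by apply/matrixP=> i j; rewrite !ord1 mx11_trE trmx_mul trmxK.
  have mxD (B C : 'M[R]_1) : (B + C) 0 0 = B 0 0 + C 0 0 by rewrite mxE.
  by rewrite !mxD !mxZ [_%:M 0 0]mxE eqxx mulr1n mulr2n; ring.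
rewrite -scaleNr -scalemxAr -mulmxA winv_wcenter //.
have -> : quad_form (winv w) (- a *: wcenter w) =
    a ^+ 2 * quad_form (winv w) (wcenter w).
  rewrite /quad_form [(_ *: _)^T]linearZ /= -!scalemxAl -scalemxAr scalerA.
  by rewrite mxZ mulrNN -expr2.
rewrite /delta /Defs.delta -/(winv w) -/(wcenter w) -/(wquad w) mxZ mulr2n.
by ring.
Qed.

(* The Schur complement of [winv w] in the constraint matrix. *)
Lemma D_matrix_psdP w : posdefmx (winv w) ->
  possemidefmx (D_matrix x P w) <-> \sum_(i < m) w 0 i - delta w <= 1.
Proof.
move=> w_pd; have w_unit := posdef_unitmx w_pd; split=> [[_ D_ge0]|le1].
  (* This vector annihilates the completed square and leaves the Schur complement alone. *)
  have := D_ge0 (col_mx 1%:M (- wcenter w)).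
  rewrite quad_form_D_matrix // scale1r addNr expr1n mul1r.
  by rewrite /quad_form mulmx0 mxE addr0; lra.
split=> [|v].
  rewrite /D_matrix -trmx_wlin (@tr_block_mx _ 1 n 1 n) tr_scalar_mx trmxK.
  by rewrite -/(winv w) winv_sym.
rewrite -[v](@vsubmxK _ 1 n 1) [usubmx v]mx11_scalar quad_form_D_matrix //.
by rewrite addr_ge0 ?quad_form_ge0 // mulr_ge0 ?sqr_ge0 //; lra.
Qed.

Lemma winvZ (a : R) w : winv (a *: w) = a *: winv w.
Proof. by rewrite scaler_sumr; apply: eq_bigr => i _; rewrite mxE scalerA. Qed.

Lemma wlinZ (a : R) w : wlin (a *: w) = a *: wlin w.
Proof. by rewrite scaler_sumr; apply: eq_bigr => i _; rewrite mxE scalerA. Qed.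

Lemma wquadZ (a : R) w : wquad (a *: w) = a * wquad w.
Proof. by rewrite mulr_sumr; apply: eq_bigr => i _; rewrite mxE mulrA. Qed.

Lemma wshapeZ (a : R) w : a != 0 -> winv w \in unitmx ->
  wshape (a *: w) = a^-1 *: wshape w.
Proof.
move=> a_neq0 w_unit; rewrite /wshape /Defs.wshape -!/(winv _) winvZ invmxZ //.
by rewrite unitmxZ ?unitfE.
Qed.

(** The factor [a^-1] of the shape cancels the factor [a] of the linear term; hence (B) and (D) can
    share their centers. *)
Lemma wcenterZ (a : R) w : a != 0 -> winv w \in unitmx ->
  wcenter (a *: w) = wcenter w.
Proof.
move=> a_neq0 w_unit; rewrite /wcenter /Defs.wcenter -!/(wshape _) -!/(wlin _).
by rewrite wshapeZ // wlinZ -scalemxAl -scalemxAr scalerA mulVf // scale1r.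
Qed.

Lemma deltaZ (a : R) w : a != 0 -> winv w \in unitmx ->
  delta (a *: w) = a * delta w.
Proof.
move=> a_neq0 w_unit.
rewrite /delta /Defs.delta -!/(winv _) -!/(wquad _) -!/(wcenter _).
by rewrite wcenterZ // wquadZ winvZ quad_formZ mulrBr.
Qed.

Lemma simplex_winv_posdef t : simplex t -> posdefmx (winv t).
Proof. by move=> [t_ge0 t1]; apply: winv_posdef; rewrite ?t1. Qed.

Lemma simplex_wshape_posdef t : simplex t -> posdefmx (wshape t).
Proof. by move=> /simplex_winv_posdef/posdef_invmx. Qed.

(** The inequalities defining the intersection are averaged with the weights [t]. *)
Lemma simplex_quad_form_le t z : simplex t -> intersection x P z ->
  quad_form (winv t) (z - wcenter t) <= 1 - delta t.
Proof.
move=> t_simplex Fz.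
have t_unit := posdef_unitmx (simplex_winv_posdef t_simplex).
case: t_simplex => t_ge0 t1; rewrite lerBrDr -weighted_quad_form // -t1.
by apply: ler_sum => i _; rewrite ler_piMr // (Fz i).
Qed.

(** Both terms of the Schur complement condition are homogeneous in the weights, so it becomes
    linear in [s] along a ray. *)
Lemma simplex_D_feasible (s : R) t : 0 < s -> simplex t ->
  D_feasible x P (s *: t) <-> s * (1 - delta t) <= 1.
Proof.
move=> s_gt0 t_simplex; have t_pd := simplex_winv_posdef t_simplex.
have st_pd : posdefmx (winv (s *: t)) by rewrite winvZ; exact: posdefZ.
have sumE : \sum_(i < m) (s *: t) 0 i - delta (s *: t) = s * (1 - delta t).
  rewrite deltaZ ?gt_eqF ?posdef_unitmx // [RHS]mulrBr mulr1; congr (_ - _).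
  by under eq_bigr do rewrite mxE; rewrite -mulr_sumr t_simplex.2 mulr1.
rewrite -sumE; split=> [[_ _ /(D_matrix_psdP st_pd)]//|le1]; split.
- by move=> i; rewrite mxE mulr_ge0 ?(ltW s_gt0) ?t_simplex.1.
- exact: posdef_unitmx.
- exact/D_matrix_psdP.
Qed.

Lemma D_feasible_simplex l : (0 < n)%N -> D_feasible x P l ->
  exists s t, [/\ 0 < s, simplex t & l = s *: t].
Proof.
move=> n_gt0 [l_ge0 l_unit _]; pose s := \sum_(i < m) l 0 i.
have s_gt0 : 0 < s.
  rewrite lt_neqAle sumr_ge0 ?andbT // eq_sym; apply/eqP => /psumr_eq0P l0.
  (* With all weights zero, [winv l] is the zero matrix, whose rank 0 is below [n]. *)
  move: l_unit; rewrite /Defs.winv big1 => [|i _].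
    by rewrite -row_free_unit /row_free mxrank0 ltn_eqF.
  by rewrite l0 ?scale0r.
exists s, (s^-1 *: l); rewrite scalerA divff ?gt_eqF // scale1r; split=> //.
split=> [i|]; first by rewrite mxE mulr_ge0 // invr_ge0 ltW.
by under eq_bigr do rewrite mxE; rewrite -mulr_sumr mulVf ?gt_eqF.
Qed.

End WeightedEllipsoids.

(** * Behavior of the objective along positive multiples of a matrix *)

Lemma le0_of_le_scale (R : realType) (n : nat) (K : R) (y : \bar R) :
  (0 < n)%N -> 0 < K -> (forall s, 0 < s -> (y <= (s ^+ n * K)%:E)%E) ->
  (y <= 0)%E.
Proof.
move=> n_gt0 K_gt0 y_le; apply/lee_addgt0Pr => e e_gt0; rewrite add0e.
(* The cap 1 gives [s ^+ n <= s], and [s <= e / K] then yields the bound [e]. *)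
pose s := Num.min 1 (e / K).
have s_gt0 : 0 < s by rewrite lt_min ltr01 divr_gt0.
apply: le_trans (y_le s s_gt0) _; rewrite lee_fin -ler_pdivlMr //.
apply: (@le_trans _ _ s); last by rewrite /s ge_min lexx orbT.
by rewrite -[leRHS]expr1 ler_wiXn2l // ?(ltW s_gt0) // /s ge_min lexx.
Qed.

Section Objective.
Context {R : realType} {n : nat} (n_gt0 : (0 < n)%N).
Context (f : 'M[R]_n -> \bar R) (f_def : f = @logdet R n \/ f = @trace R n).
Implicit Types (S : 'M[R]_n) (a b : R).

(** The scale [a = 0] is included: since [n] is positive, the determinant vanishes there, [logdet]
    is -oo, and the inequality stays strict. *)
Lemma objective_scale_lt S a b : posdefmx S -> 0 <= a -> a < b ->
  (f (a *: S) < f (b *: S))%E.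
Proof.
move=> S_pd a_ge0 ab; have b_gt0 := le_lt_trans a_ge0 ab.
have detS_gt0 := posdef_det_gt0 S_pd.
case: f_def => ->.
  rewrite /logdet !detZ lte_lne ?in_itv /= ?leey ?andbT ?lee_fin.
  - by rewrite lte_fin ltr_pM2r // ltrXn2r // -lt0n.
  - by rewrite mulr_ge0 ?exprn_ge0 // ltW.
  - by rewrite mulr_ge0 ?exprn_ge0 // ltW.
by rewrite /trace !mxtraceZ lte_fin ltr_pM2r // posdef_trace_gt0.
Qed.

Lemma objective_scale_le S a b : posdefmx S -> 0 <= a -> a <= b ->
  (f (a *: S) <= f (b *: S))%E.
Proof.
move=> S_pd a_ge0; rewrite le_eqVlt => /predU1P[->//|ab].
by rewrite ltW // objective_scale_lt.
Qed.

(** A limit as [s] tends to 0, which serves the degenerate case of radius zero. *)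
Lemma objective_scale0_ge S (y : \bar R) : posdefmx S ->
  (forall s, 0 < s -> (y <= f (s *: S))%E) -> (y <= f (0 *: S))%E.
Proof.
move=> S_pd; case: f_def => -> y_le; last first.
  rewrite /trace mxtraceZ mul0r.
  apply: (@le0_of_le_scale _ 1 (\tr S)) => // [|s /y_le].
    exact: posdef_trace_gt0.
  by rewrite /trace mxtraceZ expr1.
(* Here [f (0 *: S)] is -oo; after exponentiation the hypothesis is a bound by [s ^+ n * \det S]. *)
rewrite /logdet detZ expr0n gtn_eqF // mul0r -lee_expeR.
rewrite lneK ?in_itv /= ?lexx ?leey //.
apply: (@le0_of_le_scale _ n (\det S)) => // [|s s_gt0].
  exact: posdef_det_gt0.
have := y_le s s_gt0; rewrite /logdet detZ -lee_expeR lneK // in_itv /= leey andbT.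
by rewrite lee_fin mulr_ge0 ?exprn_ge0 // ltW // posdef_det_gt0.
Qed.

End Objective.

(** * Equality of the optimal values and of the optimal ellipsoids *)

Section Equivalence.
Context {R : realType} {m n : nat} (n_gt0 : (0 < n)%N).
Context (x : 'I_m -> 'cV[R]_n) (P : 'I_m -> 'M[R]_n).
Context (P_posdef : forall i, posdefmx (P i)).
Context (F_neq0 : intersection x P !=set0).
Context (f : 'M[R]_n -> \bar R) (f_def : f = @logdet R n \/ f = @trace R n).

Local Notation radius t := (1 - delta x P t).

Lemma radius_ge0 (t : 'rV[R]_m) : simplex t -> 0 <= radius t.
Proof.
move=> t_simplex; have [z Fz] := F_neq0.
apply: le_trans (simplex_quad_form_le P_posdef t_simplex Fz).
exact: quad_form_ge0 (simplex_winv_posdef P_posdef t_simplex).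
Qed.

Lemma D_objective_scale (s : R) (t : 'rV[R]_m) : 0 < s -> simplex t ->
  D_objective P f (s *: t) = f (s^-1 *: wshape P t).
Proof.
move=> s_gt0 t_simplex; rewrite /D_objective wshapeZ ?gt_eqF //.
exact: posdef_unitmx (simplex_winv_posdef P_posdef t_simplex).
Qed.

Lemma radius_le_invr (s : R) (t : 'rV[R]_m) : 0 < s -> simplex t ->
  D_feasible x P (s *: t) -> radius t <= s^-1.
Proof.
move=> s_gt0 t_simplex /(simplex_D_feasible x P_posdef s_gt0 t_simplex).
by rewrite -[s^-1]mul1r ler_pdivlMr // mulrC.
Qed.

Lemma B_objective_le (s : R) (t : 'rV[R]_m) : 0 < s -> simplex t ->
  D_feasible x P (s *: t) ->
  (B_objective x P f t <= D_objective P f (s *: t))%E.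
Proof.
move=> s_gt0 t_simplex /(radius_le_invr s_gt0 t_simplex) le_rs.
rewrite D_objective_scale // /B_objective objective_scale_le ?radius_ge0 //.
exact: simplex_wshape_posdef.
Qed.

Lemma simplex_radius_D_feasible (t : 'rV[R]_m) : simplex t -> 0 < radius t ->
  D_feasible x P ((radius t)^-1 *: t).
Proof.
move=> t_simplex r_gt0; apply/simplex_D_feasible; rewrite ?invr_gt0 //.
by rewrite mulVf ?gt_eqF.
Qed.

Lemma radius_D_objective (t : 'rV[R]_m) : simplex t -> 0 < radius t ->
  D_objective P f ((radius t)^-1 *: t) = B_objective x P f t.
Proof.
by move=> t_simplex r_gt0; rewrite D_objective_scale ?invr_gt0 ?invrK.
Qed.

(** Infima are compared because minima may fail to exist: if some [t] has radius zero, (B) attains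
    its infimum there, while (D) only approaches it along multiples of [t]. *)
Lemma ereal_inf_B_D :
  ereal_inf [set B_objective x P f t | t in @simplex R m]
    = ereal_inf [set D_objective P f l | l in D_feasible x P].
Proof.
apply/eqP; rewrite eq_le; apply/andP; split; apply: le_ereal_inf_tmp.
  move=> _ [l Dl <-].
  have [s [t [s_gt0 t_simplex lE]]] := D_feasible_simplex n_gt0 Dl.
  rewrite lE in Dl *; apply: le_trans (B_objective_le s_gt0 t_simplex Dl).
  by apply: ereal_inf_lbound; exists t.
move=> _ [t t_simplex <-].
have r_eq0_or_gt0 : (0 == radius t) || (0 < radius t).
  by rewrite -le_eqVlt radius_ge0.
have [r0|r_gt0] := predU1P r_eq0_or_gt0; last first.
  rewrite -radius_D_objective //; apply: ereal_inf_lbound.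
  by exists ((radius t)^-1 *: t) => //; exact: simplex_radius_D_feasible.
(* A zero radius makes every positive multiple of [t] feasible. *)
rewrite /B_objective /B_shape -r0; apply: objective_scale0_ge => // [|s s_gt0].
  exact: simplex_wshape_posdef.
apply: ereal_inf_lbound; exists (s^-1 *: t).
  by apply/simplex_D_feasible; rewrite ?invr_gt0 // -r0 mulr0.
by rewrite D_objective_scale ?invr_gt0 ?invrK.
Qed.

(** In this form the equality of the infima carries minimizers from one problem to the other. *)
Lemma minimizer_ereal_inf {T : Type} (A : set T) (g : T -> \bar R) (a : T) :
  minimizer A g a <-> A a /\ g a = ereal_inf [set g b | b in A].
Proof.
split=> [[Aa a_min]|[Aa ga]]; split=> //.
  apply/eqP; rewrite eq_le; apply/andP; split.
    by apply: le_ereal_inf_tmp => _ [b Ab <-]; exact: a_min.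
  by apply: ereal_inf_lbound; exists a.
by move=> b Ab; rewrite ga; apply: ereal_inf_lbound; exists b.
Qed.

Lemma B_shape_radius_gt0 (t : 'rV[R]_m) : simplex t ->
  posdefmx (B_shape x P t) -> 0 < radius t.
Proof.
move=> t_simplex /(posdef_trace_gt0 n_gt0); rewrite mxtraceZ pmulr_lgt0 //.
by rewrite posdef_trace_gt0 //; exact: simplex_wshape_posdef.
Qed.

(** Dividing a minimizer [t] of (B) by its radius, nonzero because [S] is positive definite, gives a
    minimizer of (D) with the same ellipsoid. Conversely, a minimizer of (D) is normalized to the
    simplex. *)
Lemma B_min_ellipsoidP (c : 'cV[R]_n) (S : 'M[R]_n) : posdefmx S ->
  B_min_ellipsoid x P f c S <-> D_min_ellipsoid x P f c S.
Proof.
move=> S_pd; split=> [[t t_min [cE SE]]|[l l_min [cE SE]]].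
  have [t_simplex t_inf] := (minimizer_ereal_inf _ _ _).1 t_min.
  have r_gt0 : 0 < radius t by apply: B_shape_radius_gt0; rewrite -?SE.
  have t_unit := posdef_unitmx (simplex_winv_posdef P_posdef t_simplex).
  exists ((radius t)^-1 *: t).
    apply/minimizer_ereal_inf; rewrite radius_D_objective // t_inf ereal_inf_B_D.
    by split=> //; exact: simplex_radius_D_feasible.
  by rewrite wcenterZ ?wshapeZ ?invrK ?invr_eq0 ?gt_eqF.
have [Dl l_inf] := (minimizer_ereal_inf _ _ _).1 l_min.
have [s [t [s_gt0 t_simplex lE]]] := D_feasible_simplex n_gt0 Dl.
rewrite {l l_min}lE in Dl l_inf cE SE.
have t_unit := posdef_unitmx (simplex_winv_posdef P_posdef t_simplex).
have inf_le : (D_objective P f (s *: t) <= B_objective x P f t)%E.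
  by rewrite l_inf -ereal_inf_B_D; apply: ereal_inf_lbound; exists t.
(* Feasibility gives one inequality. A strictly smaller radius would push the value of (B) at [t]
   below the common infimum. *)
have rE : radius t = s^-1.
  apply/eqP; rewrite eq_le (radius_le_invr s_gt0) //= leNgt.
  apply: contraTN inf_le => r_lt; rewrite -ltNge D_objective_scale //.
  apply: objective_scale_lt => //; first exact: simplex_wshape_posdef.
  exact: radius_ge0.
exists t; last first.
  by rewrite cE SE wcenterZ ?wshapeZ ?gt_eqF // /B_shape rE.
apply/minimizer_ereal_inf; split=> //; rewrite ereal_inf_B_D -l_inf.
by rewrite D_objective_scale // -rE.
Qed.

Lemma intersection_sub_ellipsoid (t : 'rV[R]_m) : simplex t ->
  posdefmx (B_shape x P t) ->
  intersection x P `<=` ellipsoid (wcenter x P t) (B_shape x P t).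
Proof.
move=> t_simplex S_pd z Fz; have r_gt0 := B_shape_radius_gt0 t_simplex S_pd.
rewrite /ellipsoid /= invmxZ ?posdef_unitmx // invmxK quad_formZ.
by rewrite mulrC ler_pdivrMr // mul1r simplex_quad_form_le.
Qed.

End Equivalence.

(** * Continuity of matrix expressions at a point *)

Section PointwiseContinuity.
Context {R : realType} {T : topologicalType} (t : T).
Implicit Types F : T -> R.

Lemma continuous_at_sum (I : Type) (r : seq I) (F : I -> T -> R) :
  (forall i, continuous_at t (F i)) ->
  continuous_at t (fun u => \sum_(i <- r) F i u).
Proof.
move=> F_cont; elim: r => [|i r IHr].
  under eq_fun do rewrite big_nil; exact: cst_continuous.
under eq_fun do rewrite big_cons; exact: continuousD (F_cont i) IHr.
Qed.

Lemma continuous_at_prod (I : Type) (r : seq I) (F : I -> T -> R) :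
  (forall i, continuous_at t (F i)) ->
  continuous_at t (fun u => \prod_(i <- r) F i u).
Proof.
move=> F_cont; elim: r => [|i r IHr].
  under eq_fun do rewrite big_nil; exact: cst_continuous.
under eq_fun do rewrite big_cons; exact: continuousM (F_cont i) IHr.
Qed.

Lemma continuous_at_scale (c : R) F :
  continuous_at t F -> continuous_at t (fun u => c * F u).
Proof. exact: continuousM (@cst_continuous T R c t). Qed.

(** Working entry by entry reduces products, determinants and adjugates to sums and products of real
    functions. *)
Definition entrywise_continuous_at p q (A : T -> 'M[R]_(p, q)) :=
  forall i j, continuous_at t (fun u => A u i j).

Lemma entrywise_continuous_cst p q (A : 'M[R]_(p, q)) :
  entrywise_continuous_at (fun=> A).
Proof. by move=> i j; exact: cst_continuous. Qed.

Lemma entrywise_continuous_tr p q (A : T -> 'M[R]_(p, q)) :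
  entrywise_continuous_at A -> entrywise_continuous_at (fun u => (A u)^T).
Proof. by move=> A_cont i j; under eq_fun do rewrite mxE; exact: A_cont. Qed.

Lemma entrywise_continuous_scale p q F (A : T -> 'M[R]_(p, q)) :
  continuous_at t F -> entrywise_continuous_at A ->
  entrywise_continuous_at (fun u => F u *: A u).
Proof.
move=> F_cont A_cont i j; under eq_fun do rewrite mxE.
exact: continuousM F_cont (A_cont i j).
Qed.

Lemma entrywise_continuous_sum (I : Type) (r : seq I) p q
    (A : I -> T -> 'M[R]_(p, q)) :
  (forall k, entrywise_continuous_at (A k)) ->
  entrywise_continuous_at (fun u => \sum_(k <- r) A k u).
Proof.
move=> A_cont i j; under eq_fun do rewrite summxE.
by apply: continuous_at_sum => k; exact: A_cont.
Qed.

Lemma entrywise_continuous_mul p q r (A : T -> 'M[R]_(p, q))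
    (B : T -> 'M[R]_(q, r)) :
  entrywise_continuous_at A -> entrywise_continuous_at B ->
  entrywise_continuous_at (fun u => A u *m B u).
Proof.
move=> A_cont B_cont i j; under eq_fun do rewrite mxE.
apply: continuous_at_sum => k.
exact: continuousM (A_cont i k) (B_cont k j).
Qed.

Lemma continuous_at_det p (A : T -> 'M[R]_p) :
  entrywise_continuous_at A -> continuous_at t (fun u => \det (A u)).
Proof.
move=> A_cont; apply: continuous_at_sum => s.
apply: continuous_at_scale.
by apply: continuous_at_prod => i; exact: A_cont.
Qed.

Lemma entrywise_continuous_adj p (A : T -> 'M[R]_p) :
  entrywise_continuous_at A -> entrywise_continuous_at (fun u => \adj (A u)).
Proof.
move=> A_cont i j; under eq_fun do rewrite mxE.
apply: continuous_at_scale.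
apply: continuous_at_det => k l; under eq_fun do rewrite !mxE.
exact: A_cont.
Qed.

Lemma continuous_at_tr p (A : T -> 'M[R]_p) :
  entrywise_continuous_at A -> continuous_at t (fun u => \tr (A u)).
Proof. by move=> A_cont; apply: continuous_at_sum => i; exact: A_cont. Qed.

End PointwiseContinuity.

(** * The simplex is nonempty and compact *)

Lemma simplex_nonempty (R : realType) (m : nat) : (0 < m)%N ->
  @simplex R m !=set0.
Proof.
move=> m_gt0; exists (delta_mx 0 (Ordinal m_gt0)); split=> [i|].
  by rewrite mxE ler0n.
rewrite (bigD1 (Ordinal m_gt0)) //= mxE !eqxx big1 ?addr0 // => i i_neq.
by rewrite mxE (negPf i_neq) andbF.
Qed.

(** The simplex is a closed subset of the unit cube. *)
Lemma simplex_compact (R : realType) (m : nat) : compact (@simplex R m).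
Proof.
have cube_compact :
    compact [set t : 'rV[R]_m | forall i, `[0, 1]%classic (t ord0 i)].
  apply: (@rV_compact R m (fun=> `[0, 1]%classic)) => i.
  exact: segment_compact.
apply: subclosed_compact cube_compact _.
- have -> : @simplex R m =
      (\bigcap_(i in [set: 'I_m]) [set t : 'rV[R]_m | 0 <= t 0 i])
      `&` [set t : 'rV[R]_m | \sum_(i < m) t 0 i = 1].
    by apply/seteqP; split=> t [t_ge0 t1]; split=> // i; [move=> _|];
      exact: t_ge0.
  apply: closedI.
    apply: closed_bigI => i _.
    apply: (@preimage_closed _ _ (fun t : 'rV[R]_m => t 0 i)
      [set r | 0 <= r]); last exact: closed_ge.
    by move=> t _; exact: coord_continuous.
  apply: (@preimage_closed _ _ (fun t : 'rV[R]_m => \sum_(i < m) t 0 i)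
    [set r | r = 1]); last exact: closed_eq.
  by move=> t _; apply: continuous_at_sum => i; exact: coord_continuous.
move=> t [t_ge0 t1] i /=; rewrite in_itv /= t_ge0 -t1 (bigD1 i) //= lerDl.
exact: sumr_ge0.
Qed.

(** * Existence of a minimizer of (B) *)

Section Existence.
Context {R : realType} {m n : nat} (n_gt0 : (0 < n)%N).
Context (x : 'I_m -> 'cV[R]_n) (P : 'I_m -> 'M[R]_n).
Context (P_posdef : forall i, posdefmx (P i)).
Implicit Types t : 'rV[R]_m.

(* At an interior point one of two distinct points of [F] is not the center. *)
Lemma radius_gt0 t : interior (intersection x P) !=set0 -> simplex t ->
  0 < 1 - delta x P t.
Proof.
move=> [z0 /nbhs_ballP[e /= e_gt0 ballF]] t_simplex.
(* The ball is taken entry by entry, so a shift of every coordinate by [e / 2] stays inside it. *)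
pose z1 := z0 + const_mx (e / 2) : 'cV[R]_n.
have e2_gt0 : 0 < e / 2 by rewrite divr_gt0.
have z1_neq : z1 != z0.
  rewrite -subr_eq0 addrC addKr; apply/eqP => /matrixP/(_ (Ordinal n_gt0) 0).
  by rewrite !mxE => /eqP; rewrite gt_eqF.
have [z Fz z_neq] : exists2 z, intersection x P z & z != wcenter x P t.
  have Fz0 : intersection x P z0 by apply: ballF; exact: ballxx.
  have Fz1 : intersection x P z1.
    apply: ballF; split=> // i j; rewrite !mxE /ball /= opprD addNKr normrN.
    by rewrite gtr0_norm // gtr_pMr // invf_lt1 // ltr1n.
  have [z0c|] := eqVneq z0 (wcenter x P t); last by exists z0.
  by exists z1 => //; rewrite -z0c.
apply: lt_le_trans (simplex_quad_form_le P_posdef t_simplex Fz).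
by have [_] := simplex_winv_posdef P_posdef t_simplex; apply; rewrite subr_eq0.
Qed.

(* Cramer's rule turns the inverse into a quotient of polynomials in the weights. *)
Let inv t : 'M[R]_n := (\det (winv P t))^-1 *: \adj (winv P t).

Let invE t : simplex t -> inv t = wshape P t.
Proof.
move=> /(simplex_winv_posdef P_posdef)/posdef_unitmx t_unit.
by rewrite /wshape /invmx t_unit.
Qed.

(** A rational expression in the weights that agrees with [B_shape] on the simplex; the quadratic
    term of [delta] is rewritten through [wlin]. *)
Let shape t : 'M[R]_n :=
  (1 - (wquad x P t - ((wlin x P t)^T *m inv t *m wlin x P t) 0 0)) *: inv t.

Let shapeE t : simplex t -> shape t = B_shape x P t.
Proof.
move=> t_simplex; rewrite /shape invE //; congr ((1 - (_ - _)) *: _).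
have t_unit := posdef_unitmx (simplex_winv_posdef P_posdef t_simplex).
rewrite /quad_form -[in RHS]mulmxA winv_wcenter // /wcenter trmx_mul /wshape.
by rewrite trmx_inv winv_sym.
Qed.

Let shape_continuous t : simplex t -> entrywise_continuous_at t shape.
Proof.
move=> t_simplex.
have coord_cont i : continuous_at t (fun u : 'rV[R]_m => u 0 i).
  exact: coord_continuous.
have winv_cont : entrywise_continuous_at t (winv P).
  apply: entrywise_continuous_sum => i; apply: entrywise_continuous_scale => //.
  exact: entrywise_continuous_cst.
have wlin_cont : entrywise_continuous_at t (wlin x P).
  apply: entrywise_continuous_sum => i; apply: entrywise_continuous_scale => //.
  exact: entrywise_continuous_cst.
have inv_cont : entrywise_continuous_at t inv.
  apply: entrywise_continuous_scale; last exact: entrywise_continuous_adj.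
  apply: continuousV (continuous_at_det winv_cont).
  by rewrite gt_eqF // posdef_det_gt0 //; exact: simplex_winv_posdef.
have wquad_cont : continuous_at t (wquad x P).
  apply: continuous_at_sum => i.
  exact: continuousM (coord_cont i) (@cst_continuous _ R _ t).
have quad_cont : entrywise_continuous_at t
    (fun u => (wlin x P u)^T *m inv u *m wlin x P u).
  apply: entrywise_continuous_mul => //; apply: entrywise_continuous_mul => //.
  exact: entrywise_continuous_tr.
apply: entrywise_continuous_scale => //.
exact: continuousB (@cst_continuous _ R 1 t)
  (continuousB wquad_cont (quad_cont 0 0)).
Qed.

Lemma B_minimizer_exists (f : 'M[R]_n -> \bar R) : (0 < m)%N ->
  f = @logdet R n \/ f = @trace R n ->
  interior (intersection x P) !=set0 ->
  exists2 t, posdefmx (B_shape x P t) &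
    minimizer (@simplex R m) (B_objective x P f) t.
Proof.
move=> m_gt0 f_def F_int.
have shape_pd t : simplex t -> posdefmx (B_shape x P t).
  move=> t_simplex; apply: posdefZ; first exact: radius_gt0.
  exact: simplex_wshape_posdef.
have min_exists (g : 'M[R]_n -> R) :
    (forall t, simplex t -> continuous_at t (fun u => g (shape u))) ->
    exists2 t, simplex t &
      forall u, simplex u -> g (B_shape x P t) <= g (B_shape x P u).
  move=> g_cont.
  have [|t] := @EVT_min_rV R m (fun u => g (shape u)) _
    (simplex_nonempty R m_gt0) (@simplex_compact R m).
    (* Continuity is available only at points of the simplex, which suffices for the subspace
       topology. *)
    rewrite continuous_subspace_in => t /set_mem t_simplex.
    by apply: continuous_subspaceT_for => //; exact: g_cont.
  rewrite inE => t_simplex t_min; exists t => // u u_simplex.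
  by rewrite -!shapeE // t_min // inE.
case: f_def => ->.
  have [t t_simplex t_min] := min_exists determinant
    (fun t t_simplex => continuous_at_det (shape_continuous t_simplex)).
  exists t; [exact: shape_pd | split=> // u u_simplex].
  (* The logarithm is increasing on [0, +oo], so a minimizer of the determinant also minimizes
     [logdet]. *)
  by rewrite /B_objective /logdet lee_lne ?lee_fin ?t_min // in_itv /= leey
    andbT lee_fin ltW // posdef_det_gt0 //; exact: shape_pd.
have [t t_simplex t_min] := min_exists (@mxtrace R n)
  (fun t t_simplex => continuous_at_tr (shape_continuous t_simplex)).
by exists t; [exact: shape_pd | split].
Qed.

End Existence.

(* In dimension 0 the weight [l = 0] is feasible for (D), so that the reduction to
   a positive multiple of a point of the simplex is not available. *)
Lemma proposition5p1_dim0 (R : realType) (m : nat) (m_gt0 : (0 < m)%N)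
    (x : 'I_m -> 'cV[R]_0) (P : 'I_m -> 'M[R]_0) (f : 'M[R]_0 -> \bar R) :
  [/\ ereal_inf [set B_objective x P f t | t in @simplex R m]
        = ereal_inf [set D_objective P f l | l in D_feasible x P],
      forall (c : 'cV[R]_0) (S : 'M[R]_0), posdefmx S ->
        B_min_ellipsoid x P f c S <-> D_min_ellipsoid x P f c S,
      forall (c : 'cV[R]_0) (S : 'M[R]_0), posdefmx S ->
        B_min_ellipsoid x P f c S -> intersection x P `<=` ellipsoid c S
    & interior (intersection x P) !=set0 ->
        exists2 cS : 'cV[R]_0 * 'M[R]_0, posdefmx cS.2
          & B_min_ellipsoid x P f cS.1 cS.2].
Proof.
have [t t_simplex] := simplex_nonempty R m_gt0.
have M0E (A B : 'M[R]_0) : A = B by rewrite [A]flatmx0 [B]flatmx0.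
have v0E (u v : 'cV[R]_0) : u = v by rewrite [u]flatmx0 [v]flatmx0.
have S_pd (S : 'M[R]_0) : posdefmx S.
  by split=> // v; rewrite (v0E v 0) eqxx.
(* The empty matrix has determinant 1, hence is invertible, and the constraint matrix at weight zero
   is the 1 by 1 identity. *)
have D0 : D_feasible x P 0.
  split=> [i||]; first by rewrite mxE.
    by rewrite unitmxE det_mx00 unitr1.
  have -> : D_matrix x P 0 = 1%:M.
    apply/matrixP => i j; rewrite /D_matrix.
    have i0 : i = lshift 0 0 by apply: val_inj; case: i => [] [].
    have j0 : j = lshift 0 0 by apply: val_inj; case: j => [] [].
    rewrite i0 j0 block_mxEul !mxE !eqxx big1 => [|k _]; last by rewrite mxE.
    by rewrite /wquad big1 ?subr0 ?addr0 // => k _; rewrite mxE mul0r.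
  split=> [|v]; first by rewrite trmx1.
  rewrite /quad_form mulmx1 mxE; apply: sumr_ge0 => k _.
  by rewrite mxE -expr2 sqr_ge0.
(* All matrices of size 0 coincide, so both objectives are constant and every feasible point is a
   minimizer. *)
have BE u : B_objective x P f u = f 0 by congr f; exact: M0E.
have DE l : D_objective P f l = f 0 by congr f; exact: M0E.
have B_min c S : B_min_ellipsoid x P f c S.
  by exists t => //; split=> // u _; rewrite !BE.
split=> [|c S _|c S _ _ z _|_].
- congr ereal_inf; apply/seteqP; split=> _ [u _ <-]; [exists 0|exists t] => //.
    by rewrite BE DE.
  by rewrite BE DE.
- by split=> // _; exists 0 => //; split=> // l _; rewrite !DE.
- by rewrite /ellipsoid /= (v0E (z - c) 0) /quad_form mulmx0 mxE ler01.
by exists (0, 0).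
Qed.

Unset Implicit Arguments.
Set Strict Implicit.

Theorem proposition5p1 (R : realType) (m n : nat) (m_gt0 : (0 < m)%N)
    (x : 'I_m -> 'cV[R]_n) (P : 'I_m -> 'M[R]_n)
    (P_posdef : forall i, posdefmx (P i))
    (F_neq0 : intersection x P !=set0)
    (F_bounded : bounded_set (intersection x P))
    (f : 'M[R]_n -> \bar R)
    (f_def : f = @logdet R n \/ f = @trace R n) :
  [/\ ereal_inf [set B_objective x P f t | t in @simplex R m]
        = ereal_inf [set D_objective P f l | l in D_feasible x P],
      forall (c : 'cV[R]_n) (S : 'M[R]_n), posdefmx S ->
        B_min_ellipsoid x P f c S <-> D_min_ellipsoid x P f c S,
      forall (c : 'cV[R]_n) (S : 'M[R]_n), posdefmx S ->
        B_min_ellipsoid x P f c S -> intersection x P `<=` ellipsoid c S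
    & interior (intersection x P) !=set0 ->
        exists2 cS : 'cV[R]_n * 'M[R]_n, posdefmx cS.2
          & B_min_ellipsoid x P f cS.1 cS.2].
Proof.
(* For [n > 0] the zero weight is infeasible in (D), so feasible weights reduce to the simplex;
   dimension 0 is treated separately. *)
have [n_gt0|] := ltnP 0 n; last first.
  rewrite leqn0 => /eqP n0; subst n.
  exact: proposition5p1_dim0.
split.
- exact: ereal_inf_B_D.
- by move=> c S; exact: B_min_ellipsoidP.
- move=> c S S_pd [t [t_simplex _] [cE SE]]; rewrite cE SE in S_pd *.
  exact: intersection_sub_ellipsoid.
move=> F_int.
have [t S_pd t_min] := B_minimizer_exists n_gt0 P_posdef m_gt0 f_def F_int.
by exists (wcenter x P t, B_shape x P t) => //; exists t.
Qed.
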